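(* Let $\mathsf{k}$ be a field of positive characteristic. For $n=1$, if $a=kb$ for positive integers $k$ and $b$, then the Hilbert-Kunz multiplicity of the intersection algebra $\mathcal B(kb,b)$ is $$\mathrm e_{HK}(\mathfrak m,\mathcal B(kb,b))=\frac{(k+1)-6kb+3k(k+3)b^2}{6kb^2}=\frac{a+b-6ab+3a^2b+9ab^2}{6ab^2}.$$
   Context: $\mathbb N=\mathbb Z_{\ge 0}$. Let $R=\mathsf{k}[x]$, $I=(x^a)$, $J=(x^b)$. The intersection algebra is $\mathcal B(a,b)=\bigoplus_{r,s\in\mathbb N}(I^r\cap J^s)$, realized as the subring $\sum_{r,s}(I^r\cap J^s)u^rv^s$ of $R[u,v]$; it has dimension 3, is spanned over $\mathsf{k}$ by the monomials $u^rv^sx^t$ with $r,s\in\mathbb N$, $t\ge\max(ar,bs)$, and $\mathfrak m$ is its homogeneous maximal ideal, generated by the monomials $\ne1$. With $p=\operatorname{char}\mathsf{k}$, $\mathrm e_{HK}(\mathfrak m,\mathcal B)=\lim_{e\to\infty}\operatorname{length}(\mathcal B/\mathfrak m^{[p^e]})/p^{3e}$. *)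

(* Defs.v *)
From HB Require Import structures.
From mathcomp Require Import all_boot all_order all_algebra.
From mathcomp Require Import all_classical all_reals all_analysis.

Set Implicit Arguments.
Unset Strict Implicit.
Unset Printing Implicit Defensive.

Import Order.TTheory GRing.Theory Num.Theory.
Local Open Scope classical_set_scope.
Local Open Scope ring_scope.

Definition is_submodule (A : nzRingType) (V : lmodType A) (U : set V) : Prop :=
  U 0 /\ forall (c : A) (x y : V), U x -> U y -> U (c *: x + y).

Section Ideals.
Variable A : comNzRingType.
Implicit Types (S I J : set A) (x y : A).

Definition is_ideal I : Prop := @is_submodule A A^o I.

Definition ideal_gen S : set A := smallest is_ideal S.

Definition ideal_pow I (r : nat) : set A :=
  ideal_gen [set x | exists f : 'I_r -> A,
                       (forall i, I (f i)) /\ x = \prod_(i < r) f i].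

Definition frobenius_power I (q : nat) : set A :=
  ideal_gen [set x ^+ q | x in I].

Lemma sub_ideal_gen S x : S x -> ideal_gen S x.
Proof. by move=> Sx K [_]; apply. Qed.

Lemma is_ideal_gen S : is_ideal (ideal_gen S).
Proof.
split=> [K [[K0 _] _] //|c x y Ix Iy K HK].
by case: (HK) => -[_ Kcl] _; apply: Kcl; [exact: Ix | exact: Iy].
Qed.

Lemma is_ideal_frobenius_power I q : is_ideal (frobenius_power I q).
Proof. exact: is_ideal_gen. Qed.

Lemma is_idealD I x y : is_ideal I -> I x -> I y -> I (x + y).
Proof. by case=> _ Icl Ix Iy; have := Icl 1 _ _ Ix Iy; rewrite scale1r. Qed.

Lemma is_idealMl I c x : is_ideal I -> I x -> I (c * x).
Proof. by case=> I0 Icl Ix; have := Icl c _ _ Ix I0; rewrite addr0. Qed.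

Lemma is_idealB I x y : is_ideal I -> I x -> I y -> I (x - y).
Proof.
by move=> idI Ix Iy; apply: is_idealD; rewrite // -mulN1r; exact: is_idealMl.
Qed.

Lemma is_ideal_sum I n (F : 'I_n -> A) :
  is_ideal I -> (forall i, I (F i)) -> I (\sum_(i < n) F i).
Proof.
move=> idI IF; elim/big_ind: _ => // [|x y]; first by case: idI.
exact: is_idealD.
Qed.

Lemma is_ideal_pow I r : is_ideal (ideal_pow I r).
Proof. exact: is_ideal_gen. Qed.

Lemma ideal_gen_mull S I y :
  is_ideal I -> (forall x, S x -> I (x * y)) ->
  forall x, ideal_gen S x -> I (x * y).
Proof.
move=> idI SI x Sx; pose K : set A := [set z | I (z * y)].
suff: K x by [].
apply: Sx; split=> //; split; first by rewrite /K /= mul0r; case: idI.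
move=> c z w; rewrite /K /= => Kz Kw; rewrite mulrDl -mulrA.
by apply: (is_idealD idI) => //; exact: is_idealMl.
Qed.

Lemma ideal_powM I r s x y :
  ideal_pow I r x -> ideal_pow I s y -> ideal_pow I (r + s) (x * y).
Proof.
move=> Ix Iy; apply: (ideal_gen_mull (is_ideal_pow _ _) _ Ix) => _ [f [If ->]].
rewrite mulrC; apply: (ideal_gen_mull (is_ideal_pow _ _) _ Iy) => _ [g [Ig ->]].
rewrite mulrC; apply: sub_ideal_gen.
exists (fun i => match fintype.split i with inl j => f j | inr j => g j end).
split; first by move=> i; case: fintype.split.
rewrite big_split_ord /=; congr (_ * _); apply: eq_bigr => i _.
  case: splitP => [j /= /val_inj -> //|j /= ij].
  by have := ltn_ord i; rewrite ij ltnNge leq_addr.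
case: splitP => [j /= ij|j /= /addnI /val_inj -> //].
by have := ltn_ord j; rewrite -ij ltnNge leq_addr.
Qed.

Lemma ideal_pow0 I x : ideal_pow I 0 x.
Proof.
rewrite -[x]mulr1; apply: (is_idealMl _ (is_ideal_pow _ _)).
apply: sub_ideal_gen; exists (fun=> 0).
by split; [case | rewrite big_ord0].
Qed.

End Ideals.

Section IntersectionAlgebra.
Variables (R : comNzRingType) (I J : set R).

(* R[u, v] is {poly {poly R}} with u the inner and v the outer indeterminate:
   f`_s`_r is the coefficient of u^r v^s in f. *)
Definition in_intersection_algebra : {pred {poly {poly R}}} :=
  fun f => `[< forall r s : nat, (ideal_pow I r `&` ideal_pow J s) f`_s`_r >].

Lemma intersection_algebra_subring : subring_closed in_intersection_algebra.
Proof.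
split.
- apply/asboolP => r s; rewrite !coef1.
  case: s => [|s] /=; last by rewrite coef0; split; apply: (is_ideal_pow _ _).1.
  rewrite coef1; case: r => [|r] /=; first by split; exact: ideal_pow0.
  by split; apply: (is_ideal_pow _ _).1.
- move=> f g /asboolP Bf /asboolP Bg; apply/asboolP => r s; rewrite !coefB.
  by case: (Bf r s) (Bg r s) => ? ? [? ?];
    split; apply: (is_idealB (is_ideal_pow _ _)).
- move=> f g /asboolP Bf /asboolP Bg; apply/asboolP => r s; rewrite coefM coef_sum.
  split; apply: (is_ideal_sum (is_ideal_pow _ _)) => j;
    rewrite coefM; apply: (is_ideal_sum (is_ideal_pow _ _)) => i.
  + have ir : (i <= r)%N by rewrite -ltnS.
    rewrite -[X in ideal_pow _ X](subnKC ir).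
    by apply: ideal_powM; [case: (Bf i j) | case: (Bg (r - i)%N (s - j)%N)].
  + have js : (j <= s)%N by rewrite -ltnS.
    rewrite -[X in ideal_pow _ X](subnKC js).
    by apply: ideal_powM; [case: (Bf i j) | case: (Bg (r - i)%N (s - j)%N)].
Qed.

HB.instance Definition _ :=
  GRing.isSubringClosed.Build {poly {poly R}} in_intersection_algebra
    intersection_algebra_subring.

Record intersection_algebra := IntersectionAlgebra {
  intersection_algebra_val :> {poly {poly R}};
  _ : intersection_algebra_val \in in_intersection_algebra
}.

HB.instance Definition _ := [isSub for intersection_algebra_val].
HB.instance Definition _ := [Choice of intersection_algebra by <:].
HB.instance Definition _ :=
  [SubChoice_isSubComNzRing of intersection_algebra by <:].

End IntersectionAlgebra.

Section QuotientModule.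
Variables (A : nzRingType) (V : lmodType A) (U : set V) (subU : is_submodule U).

Definition submodule_pred of is_submodule U : {pred V} := [pred x | x \in U].
Local Notation N := (submodule_pred subU).

Lemma submodule_pred_closed : submod_closed N.
Proof.
split; rewrite ?inE; first exact: subU.1.
by move=> c x y; rewrite !inE; exact: subU.2.
Qed.

HB.instance Definition _ :=
  GRing.isSubmodClosed.Build A V N submodule_pred_closed.

Definition quotient_module := Quotient.quot N.
HB.instance Definition _ := GRing.Zmodule.on quotient_module.

Local Open Scope quotient_scope.

Definition quotient_scale (c : A) (x : quotient_module) : quotient_module :=
  \pi_(Quotient.quot N) (c *: repr x).

Lemma pi_quotient_scale (c : A) (x : V) :
  quotient_scale c (\pi_(Quotient.quot N) x) = \pi_(Quotient.quot N) (c *: x).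
Proof.
apply/eqP; rewrite -Quotient.idealrBE -scalerBr; apply: rpredZ.
by rewrite Quotient.idealrBE reprK.
Qed.

Lemma pi_quotient_module_surj (x : quotient_module) :
  exists y : V, x = \pi_(Quotient.quot N) y.
Proof. by exists (repr x); rewrite reprK. Qed.

Lemma quotient_scaleA c d x :
  quotient_scale c (quotient_scale d x) = quotient_scale (c * d) x.
Proof.
by have [y ->] := pi_quotient_module_surj x; rewrite !pi_quotient_scale scalerA.
Qed.

Lemma quotient_scale1 : left_id 1 quotient_scale.
Proof.
move=> x; have [y ->] := pi_quotient_module_surj x.
by rewrite pi_quotient_scale scale1r.
Qed.

Lemma quotient_scaleDr : right_distributive quotient_scale +%R.
Proof.
move=> c x y; have [x' ->] := pi_quotient_module_surj x.
have [y' ->] := pi_quotient_module_surj y.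
by rewrite !pi_quotient_scale -!raddfD /= pi_quotient_scale scalerDr.
Qed.

Lemma quotient_scaleDl x :
  {morph (fun c => quotient_scale c x) : c d / c + d}.
Proof.
move=> c d; have [y ->] := pi_quotient_module_surj x.
by rewrite !pi_quotient_scale -!raddfD /= scalerDl.
Qed.

HB.instance Definition _ := GRing.Zmodule_isLmodule.Build A quotient_module
  quotient_scaleA quotient_scale1 quotient_scaleDr quotient_scaleDl.

End QuotientModule.

(* The supremum of the lengths n of strict chains M_0 < ... < M_n of
   submodules; +oo if these are unbounded. *)
Definition module_length (R : realType) (A : nzRingType) (V : lmodType A) :
    \bar R :=
  ereal_sup [set n%:R%:E | n in [set n : nat | exists M : nat -> set V,
    (forall i, (i <= n)%N -> is_submodule (M i)) /\
    (forall i, (i < n)%N -> M i `<` M i.+1)]].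

(* p is meant to be the characteristic of A and d its Krull dimension. *)
Definition has_hilbert_kunz_multiplicity (R : realType) (A : comNzRingType)
    (p d : nat) (m : set A) (l : R) : Prop :=
  (fun e : nat =>
    (module_length R
       (quotient_module (is_ideal_frobenius_power m (p ^ e)))
     * ((p ^ (d * e))%:R^-1)%:E)%E) @ \oo --> l%:E.

Section PrincipalMonomial.
Variable F : fieldType.

Definition mono_algebra (a b : nat) : comNzRingType :=
  intersection_algebra (ideal_gen [set 'X^a : {poly F}])
                       (ideal_gen [set 'X^b : {poly F}]).

(* x^t u^r v^s in F[x][u, v]. *)
Definition mono (r s t : nat) : {poly {poly {poly F}}} :=
  ('X^t)%:P%:P * ('X^r)%:P * 'X^s.

Definition mono_max_ideal (a b : nat) : set (mono_algebra a b) :=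
  ideal_gen [set f : mono_algebra a b | exists r s t : nat,
    (r, s, t) != (0, 0, 0)%N /\ \val f = mono r s t].

End PrincipalMonomial.

(* Main.v *)
Require Import Defs.
From HB Require Import structures.
From mathcomp Require Import all_boot all_order all_algebra.
From mathcomp Require Import all_classical all_reals all_analysis.
From mathcomp Require Import zify ring lra.

Set Implicit Arguments.
Unset Strict Implicit.
Unset Printing Implicit Defensive.

Import Order.TTheory GRing.Theory Num.Theory.
Local Open Scope ring_scope.

(** The algebra has the F-basis of monomials x^t u^r v^s whose exponents
    (r, s, t) lie in the cone t >= a r, t >= b s; write a = k b and q = p^e.

    In characteristic p, f |-> f^q is additive, so m^[q] is spanned by the
    monomials whose exponent is q g + v with g != 0 and v in the cone.  The
    remaining (standard) monomials form a basis of the quotient B/m^[q].  Its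
    length is their number: ordering them by decreasing degree gives a strict
    chain of ideals with one step per standard monomial, and the steps of any
    chain of ideals above m^[q] give linearly independent coefficient vectors
    ([module_length_monomial_quotient]).

    For a = k b the semigroup of the cone is generated by (0,0,1), (0,1,b) and
    (1,j,a) with 0 <= j <= k.  Comparing with these generators, the standard
    exponents above a point (r, s) are an interval of t's that starts at
    b max(k r, s) ([standard_not_shift], [nonstandard_shift]), and its length is
    given by the ramp y |-> min(q, b y).  Reindexing, the number of standard
    exponents is
      q^3 + sum_(r < q) sum_(i < k q) ramp (k r - i)
          + k sum_(j < q) sum_(i < q) ramp (j - k i),
    where subtraction is truncated at zero ([sum_column_heightE]).

    With c = q / b the ramp is b (max(0,y) - max(0,y-c)), and its iterated
    primitives are b/2 (max(0,y)^2 - max(0,y-c)^2) and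
    b/6 (max(0,y)^3 - max(0,y-c)^3) =: H(y).  Replacing sums by primitives costs
    O(q^2), so the count is q^3 + H(k q) / k + H(q) + O(q^2); the main term is
    the stated multiplicity times q^3 ([sum_column_height_approx]). *)

(** * Length of a quotient module *)

Section QuotientLength.
Variables (R : realType) (A : nzRingType) (V : lmodType A) (U : set V).
Variable subU : is_submodule U.
Local Notation Q := (quotient_module subU).
Local Open Scope classical_set_scope.

Let pi (x : V) : Q := (\pi_(Quotient.quot (submodule_pred subU)) x)%qT.

Let piD x y : pi (x + y) = pi x + pi y.
Proof. exact: raddfD. Qed.

Let piZ c x : pi (c *: x) = c *: pi x.
Proof. by rewrite [RHS]pi_quotient_scale. Qed.

Let pi_repr (y : Q) : pi (repr y) = y.
Proof. exact: reprK. Qed.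

Let pi_eq x y : pi x = pi y -> U (x - y).
Proof.
by move=> /eqP; rewrite -Quotient.idealrBE => /set_mem.
Qed.

Let eq_pi x y : U (x - y) -> pi x = pi y.
Proof.
by move=> Uxy; apply/eqP; rewrite -Quotient.idealrBE; apply/mem_set.
Qed.

Definition chain_above (n : nat) (K : nat -> set V) : Prop :=
  (forall i, (i <= n)%N -> is_submodule (K i) /\ U `<=` K i) /\
  (forall i, (i < n)%N -> K i `<` K i.+1).

(** By the correspondence between submodules of the quotient and submodules
    above U, the length can be computed with chains upstairs. *)
Lemma module_length_quotientE (N : nat) :
  (forall n K, chain_above n K -> (n <= N)%N) ->
  (exists K, chain_above N K) ->
  module_length R Q = N%:R%:E.
Proof.
move=> ub [K [Ksub Klt]]; apply/eqP; rewrite eq_le; apply/andP; split.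
- apply: ge_ereal_sup => _ [n [M [Msub Mlt]] <-].
  rewrite lee_fin ler_nat; apply: (ub n (fun i => pi @^-1` M i)); split => i le_in.
  + have [M0 Mcl] := Msub _ le_in; split.
      split => [|c x y] /=; rewrite ?piD ?piZ; last exact: Mcl.
      by rewrite /preimage /= (_ : pi 0 = 0) // /pi raddf0.
    move=> x Ux; rewrite /preimage /= (_ : pi x = 0) // -(raddf0 pi).
    by apply: eq_pi; rewrite subr0.
  + have [sM nM] := Mlt _ le_in; split=> [x|nK]; first exact: sM.
    apply: nM => y; rewrite -(pi_repr y) => My.
    exact: (nK (repr y) My).
- apply: ereal_sup_ubound; exists N => //.
  exists (fun i => pi @` K i); split => i le_iN.
  + have [[K0 Kcl] _] := Ksub _ le_iN; split; first by exists 0 => //; rewrite /pi raddf0.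
    move=> c _ _ [x Kx <-] [y Ky <-]; exists (c *: x + y); first exact: Kcl.
    by rewrite piD piZ.
  + have [sK nK] := Klt _ le_iN; have [[K0 Kcl] UK] := Ksub _ (ltnW le_iN).
    split=> [_ [x Kx <-]|nM]; first by exists x => //; apply: sK.
    apply: nK => x Kx; have [|y Ky /esym/pi_eq/UK Kxy] := nM (pi x); first by exists x.
    by have := Kcl 1 _ _ Kxy Ky; rewrite scale1r subrK.
Qed.

End QuotientLength.

(** * Coefficients of trivariate polynomials *)

Section Trivariate.
Variable F : fieldType.
Implicit Types (f g : {poly {poly {poly F}}}) (w : nat * nat * nat).
Local Open Scope classical_set_scope.

(** Exponents are ordered as (r, s, t) for x^t u^r v^s, matching [mono]. *)
Definition coef3 f w : F := f`_w.1.2`_w.1.1`_w.2.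

Lemma coef3D f g w : coef3 (f + g) w = coef3 f w + coef3 g w.
Proof. by rewrite /coef3 !coefD. Qed.

Lemma coef3_0 w : coef3 0 w = 0.
Proof. by rewrite /coef3 !coef0. Qed.

Lemma coef3C c f w : coef3 (c%:P%:P%:P * f) w = c * coef3 f w.
Proof. by rewrite /coef3 !coefCM. Qed.

Lemma coef3_sum (I : Type) (s : seq I) (P : pred I)
    (G : I -> {poly {poly {poly F}}}) w :
  coef3 (\sum_(i <- s | P i) G i) w = \sum_(i <- s | P i) coef3 (G i) w.
Proof. by rewrite /coef3 !coef_sum. Qed.

Lemma coef3_mono r s t w : coef3 (mono F r s t) w = ((r, s, t) == w)%:R.
Proof.
rewrite /coef3 /mono mulrC coefXnM; move: w => [[r' s'] t'] /=.
rewrite !xpair_eqE; have [lt|ge] := ltnP s' s.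
  by rewrite !coef0 (gtn_eqF lt) andbF.
rewrite -polyCM coefC subn_eq0 (_ : (s == s') = (s' <= s)%N); last by rewrite eqn_leq ge.
case: ifP => [_|_]; last first.
  by rewrite !coef0 andbF.
rewrite coefCM coefXn; rewrite eq_sym; case: eqP => _; last by rewrite mulr0 coef0.
by rewrite mulr1 coefXn /= eq_sym.
Qed.

Lemma coef3_inj f g : (forall w, coef3 f w = coef3 g w) -> f = g.
Proof.
by move=> h; apply/polyP => s; apply/polyP => r; apply/polyP => t; exact: (h (r, s, t)).
Qed.

Lemma coef3M_eq0 f g w :
  (forall r s t r' s' t', (r + r', s + s', t + t')%N = w ->
     coef3 f (r, s, t) * coef3 g (r', s', t') = 0) ->
  coef3 (f * g) w = 0.
Proof.
move: w => [[r s] t] h; rewrite /coef3 coefM !coef_sum big1 // => j _.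
rewrite /= coefM !coef_sum big1 // => i _; rewrite coefM big1 // => l _.
apply: (h i j l (r - i)%N (s - j)%N (t - l)%N).
by rewrite !subnKC // -ltnS.
Qed.

Lemma mono_mul r s t r' s' t' :
  mono F r s t * mono F r' s' t' = mono F (r + r') (s + s') (t + t').
Proof.
rewrite /mono mulrACA -exprD; congr (_ * _).
by rewrite -!polyCM mulrACA -exprD -polyCM -exprD.
Qed.

Lemma mono_exp r s t q : mono F r s t ^+ q = mono F (q * r) (q * s) (q * t).
Proof. by rewrite /mono !exprMn -!rmorphXn /= -!exprM ![(_ * q)%N]mulnC. Qed.

(** A common bound n for the three exponents keeps the index sets of the sums
    independent of each other. *)
Lemma poly3_expand f : exists n, f =
  \sum_(s < n) \sum_(r < n) \sum_(t < n)
     (coef3 f (nat_of_ord r, nat_of_ord s, nat_of_ord t))%:P%:P%:P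
       * mono F r s t.
Proof.
(* Every exponent that occurs in f is below n in all three coordinates. *)
pose n := (size f + \max_(s < size f) (size (f`_s)%R +
  \max_(r < size (f`_s)%R) size (f`_s`_r)%R))%N.
have bnd w : coef3 f w != 0 -> [&& w.1.1 < n, w.1.2 < n & w.2 < n]%N.
  move: w => [[r s] t]; rewrite /coef3 /= => nz.
  have lt1 : (s < size f)%N.
    by rewrite ltnNge; apply: contra nz => h; rewrite [f`_s]nth_default // !coef0.
  have lt2 : (r < size (f`_s)%R)%N.
    by rewrite ltnNge; apply: contra nz => h; rewrite [f`_s`_r]nth_default // coef0.
  have lt3 : (t < size (f`_s`_r)%R)%N.
    by rewrite ltnNge; apply: contra nz => h; rewrite nth_default.
  have := @leq_bigmax _ (fun s : 'I_(size f) => size (f`_s)%R +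
    \max_(r < size (f`_s)%R) size (f`_s`_r)%R)%N (Ordinal lt1).
  have := @leq_bigmax _ (fun r : 'I_(size (f`_s)%R) => size f`_s`_r) (Ordinal lt2).
  rewrite /n /=; move: (\max_(_ < _) _)%N (\max_(_ < _) _)%N => m1 m2.
  move: lt1 lt2 lt3; move: (size _) (size _) (size _) => n1 n2 n3; lia.
exists n; apply: coef3_inj => -[[r s] t].
have E : forall x (G : nat -> F), (forall i, i != x -> G i = 0) ->
    (~~ (x < n)%N -> G x = 0) -> \sum_(i < n) G i = G x.
  move=> x G G0 Gx; have [xn|xn] := boolP (x < n)%N.
    rewrite (bigD1 (Ordinal xn)) //= big1 ?addr0 // => i ix; apply: G0.
    by apply: contra ix => /eqP ix; apply/eqP/val_inj.
  rewrite Gx // big1 // => i _; apply: G0.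
  by apply: contraNneq xn => <-.
have cf r' s' t' : coef3 ((coef3 f (r', s', t'))%:P%:P%:P * mono F r' s' t') (r, s, t)
    = coef3 f (r, s, t) * ((r', s', t') == (r, s, t))%:R.
  by rewrite coef3C coef3_mono; case: eqP => [->//|_]; rewrite !mulr0.
rewrite coef3_sum.
under eq_bigr => s' _ do rewrite coef3_sum.
under eq_bigr => s' _ do under eq_bigr => r' _ do rewrite coef3_sum.
under eq_bigr => s' _ do under eq_bigr => r' _ do under eq_bigr => t' _ do rewrite cf.
have nz0 : (~~ [&& r < n, s < n & t < n]%N) -> coef3 f (r, s, t) = 0.
  by move=> h; apply/eqP; apply: contraNT h => /bnd.
rewrite (E s (fun s' => \sum_(r' < n) \sum_(t' < n) coef3 f (r, s, t) *
   ((nat_of_ord r', s', nat_of_ord t') == (r, s, t))%:R)); first last.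
- by move=> h; rewrite big1 // => i _; rewrite big1 // => j _;
    rewrite nz0 ?mul0r //; apply: contra h => /and3P[].
- by move=> i /negPf h; rewrite big1 // => l _; rewrite big1 // => j _;
    rewrite !xpair_eqE h andbF mulr0.
rewrite (E r (fun r' => \sum_(t' < n) coef3 f (r, s, t) *
   ((r', s, nat_of_ord t') == (r, s, t))%:R)); first last.
- by move=> h; rewrite big1 // => i _;
    rewrite nz0 ?mul0r //; apply: contra h => /and3P[].
- by move=> i /negPf h; rewrite big1 // => l _; rewrite !xpair_eqE h mulr0.
rewrite (E t (fun t' => coef3 f (r, s, t) *
   ((r, s, t') == (r, s, t))%:R)); first last.
- by move=> h; rewrite nz0 ?mul0r //; apply: contra h => /and3P[].
- by move=> i /negPf h; rewrite !xpair_eqE h andbF mulr0.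
by rewrite eqxx mulr1.
Qed.

Lemma ideal_powXn a r (f : {poly F}) :
  ideal_pow (ideal_gen [set 'X^a]) r f <-> (forall t, (t < a * r)%N -> f`_t = 0).
Proof.
pose K n : set {poly F} := [set f : {poly F} | exists g : {poly F}, f = g * 'X^n].
have Kid n : is_ideal (K n).
  split; first by exists 0; rewrite mul0r.
  move=> c _ _ [g ->] [h ->]; exists (c * g + h).
  by rewrite -[_ *: _]/(_ * _) mulrA mulrDl.
have KE n (g : {poly F}) : K n g <-> (forall t, (t < n)%N -> g`_t = 0).
  split=> [[h ->] t tn|h]; first by rewrite coefMXn tn.
  exists (drop_poly n g); rewrite -[LHS](poly_take_drop n).
  rewrite (_ : take_poly n g = 0) ?add0r //; apply/polyP => t.
  by rewrite coef_take_poly coef0; case: ifP => // /h.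
rewrite -KE; split=> [|[g ->]].
  apply; split; first exact: Kid.
  move=> _ [h [Ih ->]].
  have {}Ih i : K a (h i).
    by apply: Ih; split; [exact: Kid | move=> _ ->; exists 1; rewrite mul1r].
  elim: r h Ih => [|r IHr] h Ih; first by rewrite muln0; exists 1; rewrite big_ord0 mulr1.
  rewrite big_ord_recr /=; have [u ->] := Ih ord_max.
  have [v ->] := IHr (fun i => h (widen_ord (leqnSn r) i)) (fun i => Ih _).
  by exists (v * u); rewrite mulrACA -exprD mulnS addnC.
apply: (is_idealMl _ (is_ideal_pow _ _)).
apply: sub_ideal_gen; exists (fun=> 'X^a); split=> [i|]; first exact: sub_ideal_gen.
by rewrite prodr_const card_ord -exprM.
Qed.

End Trivariate.

(** * Standard exponents *)

Definition in_cone a b (w : nat * nat * nat) :=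
  ((a * w.1.1 <= w.2) && (b * w.1.2 <= w.2))%N.

(** The cone shifted by q (0, 1, b) or q (1, j, k b) starts b y above the floor
    of the cone, for a y depending on (r, s) and the generator; the cone shifted
    by q (0, 0, 1) starts q above it, which makes q a cap. *)
Definition ramp q b y := minn q (b * y)%N.

(** The number of standard exponents above (r, s).  For r < q <= s the relevant
    shift is the one by q (0, 1, b).  For r >= q it is the one by q (1, j, k b)
    with j <= k and q j <= s as large as possible; when s < k q it leaves s mod q.
    A difference truncated to 0 means that every exponent above (r, s) is such a
    shift. *)
Definition column_height q b k r s :=
  if (r < q)%N then if (s < q)%N then q else ramp q b (k * r + q - s)
  else if (s < k * q)%N then ramp q b (s %% q + k * q - k * r) else 0%N.

Definition floor_height b k r s := (b * maxn (k * r) s)%N.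

Lemma floor_heightE b k r s t :
  (floor_height b k r s <= t)%N = ((k * b * r <= t) && (b * s <= t))%N.
Proof. rewrite /floor_height; apply/idP/andP; nia. Qed.

(** An exponent q g + v with g != 0 lies above the standard interval.  If g has
    first coordinate zero it dominates q (0, 0, 1) or q (0, 1, b); otherwise
    t >= q k b + b (s mod q), the bound imposed by the generator
    (1, s / q, k b) when s < k q. *)
Lemma standard_not_shift q b k g w : (0 < q)%N -> (0 < b)%N ->
  g != (0, 0, 0)%N -> in_cone (k * b) b g -> in_cone (k * b) b w ->
  let r := (q * g.1.1 + w.1.1)%N in let s := (q * g.1.2 + w.1.2)%N in
  (floor_height b k r s + column_height q b k r s <= q * g.2 + w.2)%N.
Proof.
move: g w => [[g1 g2] g3] [[r s] t] /= q0 b0; rewrite !xpair_eqE /in_cone /=.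
move=> g0 /andP[g13 g23] /andP[rt st].
have bq : (q <= b * q)%N by rewrite leq_pmull.
set r' := (_ + r)%N; set s' := (_ + s)%N; set t' := (_ + t)%N.
have [g10|g1p] := posnP g1.
- have [g20|g2p] := posnP g2.
  + have g3p : (0 < g3)%N by lia.
    have -> : r' = r by rewrite /r' g10; lia.
    have -> : s' = s by rewrite /s' g20; lia.
    have : (column_height q b k r s <= q)%N.
      by rewrite /column_height /ramp; do ![case: ifP => _ //]; rewrite ?geq_minl.
    have : (floor_height b k r s <= t)%N by rewrite floor_heightE rt st.
    have : (q <= q * g3)%N by rewrite leq_pmulr.
    rewrite /t'; lia.
  + have -> : r' = r by rewrite /r' g10; lia.
    have qs : (q <= s')%N by rewrite /s' (leq_trans (leq_pmulr q g2p)) ?leq_addr.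
    have t1 : (b * (k * r) + b * q <= t')%N.
      rewrite /t'; have : (q * (b * g2) <= q * g3)%N by rewrite leq_mul2l g23 orbT.
      have : (b * q <= q * (b * g2))%N by rewrite mulnCA leq_mul2l leq_pmulr // orbT.
      by move: rt; rewrite -mulnA mulnCA; lia.
    have t2 : (b * s' <= t')%N.
      rewrite /s' /t' mulnDr; apply: leq_add => //.
      by rewrite mulnCA leq_mul2l g23 orbT.
    rewrite /column_height /floor_height /ramp; case: ifP => rq.
      rewrite ltnNge qs /=.
      have [h1|h1] := leqP s' (k * r).
        have : (minn q (b * (k * r + q - s')) <= q)%N by rewrite geq_minl.
        lia.
      have [h2|h2] := leqP s' (k * r + q); last first.
        by rewrite (_ : (_ - s' = 0)%N) ?muln0 ?minn0 ?addn0 //; lia.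
      apply: (@leq_trans (b * s' + b * (k * r + q - s'))%N).
        by rewrite leq_add2l geq_minr.
      by rewrite -mulnDr subnKC // mulnDr.
    case: ifP => sk; last first.
      by rewrite addn0; case: (leqP (k * r) s') => _ //; lia.
    have : (k * q <= k * r)%N by rewrite leq_mul2l; lia.
    move=> h; rewrite (maxn_idPl _); last by lia.
    by apply: leq_trans t1; rewrite leq_add2l (leq_trans (geq_minl _ _)).
- have qr : (q <= r')%N by rewrite /r' (leq_trans (leq_pmulr q g1p)) ?leq_addr.
  rewrite /column_height ltnNge qr /=.
  have t1 : (b * (k * r') <= t')%N.
    rewrite /r' /t' mulnA (mulnC b) mulnDr; apply: leq_add => //.
    by rewrite mulnCA leq_mul2l g13 orbT.
  have t2 : (b * s' <= t')%N.
    rewrite /s' /t' mulnDr; apply: leq_add => //.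
    by rewrite mulnCA leq_mul2l g23 orbT.
  case: ifP => sk; last first.
    by rewrite addn0 /floor_height; case: (leqP (k*r') s').
  have kqr : (k * q <= k * r')%N by rewrite leq_mul2l qr orbT.
  rewrite /floor_height (maxn_idPl _); last by lia.
  have t3 : (b * (s' %% q + k * q) <= t')%N.
    have sE : (s' %% q <= s)%N by rewrite /s' mulnC modnMDl leq_mod.
    rewrite /t' mulnDr addnC; apply: leq_add.
      have : (q * (k * b * g1) <= q * g3)%N by rewrite leq_mul2l g13 orbT.
      apply: leq_trans; rewrite (mulnC k q) mulnCA leq_mul2l; apply/orP; right.
      by rewrite mulnC leq_pmulr.
    by apply: leq_trans st; rewrite leq_mul2l sE orbT.
  rewrite /ramp; apply: (@leq_trans (b * (k * r') + b * (s' %% q + k * q - k * r')))%N.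
    by rewrite leq_add2l geq_minr.
  rewrite -mulnDr; case: (leqP (k * r') (s' %% q + k * q)) => h.
    by rewrite subnKC.
  by rewrite (_ : (_ - _ = 0)%N) ?addn0 //; lia.
Qed.

(** Conversely one can always divide by the q-th power of a generator: by
    (0, 0, 1) if t is at least q above the floor, else by (0, 1, b) if r < q,
    and by (1, min(k, s / q), k b) if r >= q. *)
Lemma nonstandard_shift q b k w : (0 < q)%N -> (0 < b)%N -> (0 < k)%N ->
  in_cone (k * b) b w ->
  ~~ [&& w.1.1 < 2 * q, w.1.2 < k.+1 * q &
    w.2 < floor_height b k w.1.1 w.1.2 + column_height q b k w.1.1 w.1.2]%N ->
  exists g v : nat * nat * nat, [/\ g != (0, 0, 0)%N, in_cone (k * b) b g,
    in_cone (k * b) b v & w = (q * g.1.1 + v.1.1, q * g.1.2 + v.1.2, q * g.2 + v.2)%N].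
Proof.
move: w => [[r s] t] q0 b0 k0; rewrite /in_cone /= => rst nD.
have fh : (floor_height b k r s <= t)%N by rewrite floor_heightE.
have tE : (b * (k * r) <= t)%N by case/andP: rst; nia.
have tE2 : (b * s <= t)%N by case/andP: rst.
suff [g1 [g2 [g3 [g0 g13 g23 [h1 h2 h3] [h4 h5]]]]] : exists g1 g2 g3,
  [/\ (g1, g2, g3) != (0, 0, 0)%N, (k * b * g1 <= g3)%N, (b * g2 <= g3)%N,
   [/\ q * g1 <= r, q * g2 <= s & q * g3 <= t]%N &
   (q * g3 + k * b * (r - q * g1) <= t)%N /\ (q * g3 + b * (s - q * g2) <= t)%N].
  exists (g1, g2, g3), (r - q * g1, s - q * g2, t - q * g3)%N; split => //=.
  - by rewrite g13 g23.
  - by rewrite leq_subRL // h4 leq_subRL.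
  - by rewrite !subnKC.
have [tq|tq] := leqP (floor_height b k r s + q) t.
  exists 0%N, 0%N, 1%N; rewrite !muln0 !muln1 !subn0; split => //; first by split => //; lia.
  by move: tq; rewrite /floor_height; case: (leqP (k * r) s) => h; split; nia.
have [rq|qr] := ltnP r q.
- have [sq|qs] := ltnP s q.
    move: nD; rewrite /column_height rq sq; nia.
  have nL : (floor_height b k r s + column_height q b k r s <= t)%N.
    rewrite leqNgt; apply/negP => tL; move/negP: nD; apply.
    rewrite tL andbT; apply/andP; split; first by lia.
    rewrite ltnNge; apply/negP => sk; move: tL.
    rewrite /column_height rq (ltnNge s q) qs /= /ramp.
    have kr : (k * r <= k * q)%N by rewrite leq_mul2l ltnW ?orbT.
    rewrite (_ : (k * r + q - s = 0)%N); last by rewrite mulSn in sk; lia.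
    by rewrite muln0 minn0 addn0 ltnNge floor_heightE rst.
  exists 0%N, 1%N, b; rewrite !muln0 !muln1 !subn0; split => //; try lia.
    by split => //; nia.
  have bkrq : (b * (k * r) + b * q <= t)%N.
    move: nL tq; rewrite /column_height rq (ltnNge s q) qs /= /ramp /floor_height.
    by case: (leqP (k * r) s) => h; case: leqP => h'; nia.
  split; nia.
- have [sk|ks] := ltnP s (k * q); last first.
    exists 1%N, k, (k * b)%N; rewrite !muln1.
    have bk : (b * (k * q) <= b * s)%N by rewrite leq_mul2l ks orbT.
    have bk2 : (b * (k * q) <= b * (k * r))%N by rewrite !leq_mul2l qr !orbT.
    split; rewrite ?xpair_eqE //; try lia.
    by split; lia.
  have kqr : (k * q <= k * r)%N by rewrite leq_mul2l qr orbT.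
  have nL : (floor_height b k r s + column_height q b k r s <= t)%N.
    rewrite leqNgt; apply/negP => tL; move/negP: nD; apply.
    rewrite tL andbT; apply/andP; split; last by rewrite mulSn; lia.
    rewrite ltnNge; apply/negP => sk'; move: tL.
    rewrite /column_height (ltnNge r q) qr sk /= /ramp.
    have kr : (k * (2 * q) <= k * r)%N by rewrite leq_mul2l sk' orbT.
    have sm := ltn_pmod s q0.
    have kq : (q <= k * q)%N by rewrite leq_pmull.
    rewrite (_ : (_ - k * r = 0)%N); last by lia.
    by rewrite muln0 minn0 addn0 ltnNge floor_heightE rst.
  exists 1%N, (s %/ q)%N, (k * b)%N; rewrite !muln1.
  have sE := divn_eq s q; set j := (s %/ q)%N in sE *.
  have jk : (j <= k)%N by rewrite ltnW // ltn_divLR.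
  have bk2 : (b * (k * q) <= b * (k * r))%N by rewrite leq_mul2l kqr orbT.
  have tt : (b * (s %% q + k * q) <= t)%N.
    move: nL tq; rewrite /column_height (ltnNge r q) qr sk /= /ramp /floor_height.
    rewrite (maxn_idPl _); last by lia.
    case: (leqP (s %% q + k * q) (k * r)) => h.
      by move=> *; apply: leq_trans tE; rewrite leq_mul2l h orbT.
    case: (leqP q (b * (s %% q + k * q - k * r))) => h'; first by lia.
    by move=> + _; rewrite -mulnDr subnKC // ltnW.
  split => //; rewrite ?xpair_eqE //.
  + by rewrite mulnC leq_mul2r jk orbT.
  + split; lia.
  + split; first by rewrite mulnBr; lia.
    by rewrite (_ : (s - q * j = s %% q)%N); [rewrite mulnDr in tt; lia | lia].
Qed.

(** * Summing truncated powers *)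

Section PositivePowers.
Variable R : realDomainType.
Implicit Types x k : R.

Definition pospow (n : nat) x : R := Num.max 0 x ^+ n.

Lemma pospow_le0 n x : x <= 0 -> pospow n.+1 x = 0.
Proof. by move=> x0; rewrite /pospow max_l // expr0n. Qed.

Lemma pospow_ge0 n x : 0 <= x -> pospow n x = x ^+ n.
Proof. by move=> x0; rewrite /pospow max_r. Qed.

(** Discrete form of (d/dx) x^2 = 2 x for the truncated powers, with backward
    difference quotient; the error is uniform in x because the truncated square
    has a Lipschitz derivative. *)
Lemma pospow2_step k x : 0 <= k ->
  `|pospow 2 x - pospow 2 (x - k) - 2 * k * pospow 1 x| <= k ^+ 2.
Proof.
move=> k0; rewrite ler_norml.
have [x0|x0] := leP x 0.
  have xk0 : x - k <= 0 by lra.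
  by rewrite !(pospow_le0 _ x0) (pospow_le0 _ xk0); apply/andP; split; nra.
have x0' := ltW x0; have [xk|xk] := leP x k.
  rewrite [pospow 2 (_ - _)]pospow_le0; last by lra.
  by rewrite !(pospow_ge0 _ x0'); apply/andP; split; nra.
have xk0 : 0 <= x - k by lra.
by rewrite !(pospow_ge0 _ x0') (pospow_ge0 _ xk0); apply/andP; split; nra.
Qed.

(** The forward difference is the one that matches sums over r < q of values at
    k r, with no boundary term. *)
Lemma pospow3_step k x : 0 <= k ->
  `|pospow 3 (x + k) - pospow 3 x - 3 * k * pospow 2 x|
    <= 3 * k ^+ 2 * pospow 1 x + k ^+ 3.
Proof.
move=> k0; rewrite ler_norml.
have k3 : 0 <= k ^+ 3 by rewrite exprn_ge0.
have [xk|xk] := leP (x + k) 0.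
  have x0 : x <= 0 by lra.
  by rewrite !(pospow_le0 _ x0) (pospow_le0 _ xk); apply/andP; split; lra.
have [x0|x0] := leP x 0.
  rewrite !(pospow_le0 _ x0) (pospow_ge0 _ (ltW xk)).
  have : 0 <= (x + k) ^+ 3 <= k ^+ 3.
    by rewrite (exprn_ge0 3 (ltW xk)) /= ler_pXn2r ?nnegrE //; lra.
  by move=> /andP[h1 h2]; apply/andP; split; lra.
rewrite (pospow_ge0 _ (ltW xk)) !(pospow_ge0 _ (ltW x0)).
have h : 0 <= k ^+ 2 * x by rewrite mulr_ge0 ?exprn_ge0 // ltW.
apply/andP; split; nra.
Qed.

Lemma telescope_approx (Phi phi : nat -> R) (e : R) n :
  (forall i, (i < n)%N -> `|Phi i.+1 - Phi i - phi i| <= e) ->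
  `|Phi n - Phi 0%N - \sum_(i < n) phi i| <= n%:R * e.
Proof.
elim: n => [|n IHn] h; first by rewrite big_ord0 subrr subr0 normr0 mul0r.
rewrite big_ord_recr /= -natr1 mulrDl mul1r.
rewrite (_ : _ - _ = (Phi n - Phi 0%N - \sum_(i < n) phi i)
  + (Phi n.+1 - Phi n - phi n)); last by ring.
apply: le_trans (ler_normD _ _) _; apply: lerD; last exact: h.
by apply: IHn => i lt_in; apply: h; apply: leq_trans lt_in _.
Qed.

End PositivePowers.

(** * Asymptotic number of standard exponents *)

Lemma sum_modn_block (F : nat -> nat) q k :
  (\sum_(0 <= s < k * q) F (s %% q) = k * \sum_(j < q) F j)%N.
Proof.
elim: k => [|k IHk]; first by rewrite !mul0n big_geq.
rewrite mulSnr (big_cat_nat (n := (k * q)%N)) ?leq_addr //= IHk mulSnr.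
congr addn; rewrite -{1}[(k * q)%N]add0n big_addn addKn big_mkord.
by apply: eq_bigr => j _; rewrite addnC modnMDl modn_small.
Qed.

(** The first double sum collects the points with r < q <= s, after i = s - q;
    the second those with r >= q and s < k q, after i = r - q, where s enters
    only through s mod q and every residue occurs k times. *)
Lemma sum_column_heightE q b k : (0 < b)%N ->
  (\sum_(r < 2 * q) \sum_(s < k.+1 * q) column_height q b k r s =
   q ^ 3 + \sum_(r < q) \sum_(i < k * q) ramp q b (k * r - i)
         + k * \sum_(j < q) \sum_(i < q) ramp q b (j - k * i))%N.
Proof.
move=> b0.
rewrite -(big_mkord xpredT (fun r => \sum_(s < k.+1 * q) column_height q b k r s)%N).
rewrite mul2n -addnn (big_cat_nat (n := q)) ?leq_addr //=; congr addn.
- rewrite big_mkord (_ : q ^ 3 = \sum_(r < q) q * q)%N; last first.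
    by rewrite sum_nat_const card_ord; lia.
  rewrite -big_split; apply: eq_bigr => -[r rq] _ /=.
  rewrite -(big_mkord xpredT (fun s => column_height q b k r s)).
  rewrite mulSn (big_cat_nat (n := q)) ?leq_addr //=; congr addn.
    rewrite big_mkord (eq_bigr (fun=> q)) ?sum_nat_const ?card_ord // => -[s sq] _.
    by rewrite /column_height /= rq sq.
  rewrite -{1}[q]add0n big_addn addKn big_mkord; apply: eq_bigr => i _.
  by rewrite /column_height rq ltnNge leq_addl /= subnDr.
- rewrite -{1}[q]add0n big_addn addKn big_mkord.
  rewrite [in RHS]exchange_big big_distrr /=; apply: eq_bigr => i _.
  rewrite -(sum_modn_block (fun j => ramp q b (j - k * i))).
  rewrite -(big_mkord xpredT (fun s => column_height q b k _ s)).
  rewrite mulSn addnC (big_cat_nat (n := (k * q)%N)) ?leq_addr //=.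
  rewrite [X in (_ + X)%N]big_nat_cond [X in (_ + X)%N]big1 ?addn0 => [|s /andP[/andP[ks _] _]].
    rewrite big_nat_cond [RHS]big_nat_cond; apply: eq_bigr => s /andP[/andP[_ sk] _].
    by rewrite /column_height ltnNge leq_addl sk /= mulnDr subnDr.
  by rewrite /column_height ltnNge leq_addl /= ltnNge ks.
Qed.

Section CountApprox.
Variables (R : realFieldType) (b q : nat).
Hypotheses (b0 : (0 < b)%N).
Let c : R := q%:R / b%:R.
Implicit Types x kappa : R.

Let rampR x : R := b%:R * (pospow 1 x - pospow 1 (x - c)).
Let ramp_int x : R := b%:R / 2 * (pospow 2 x - pospow 2 (x - c)).
Let ramp_int2 x : R := b%:R / 6 * (pospow 3 x - pospow 3 (x - c)).

Let bR : 0 < b%:R :> R. Proof. by rewrite ltr0n. Qed.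
Let c_ge0 : 0 <= c. Proof. by rewrite divr_ge0 ?ler0n. Qed.

(* Extending the ramp by 0 to negative arguments absorbs the truncation of the
   subtraction in nat. *)
Let rampRE z i : (ramp q b (z - i))%:R = rampR (z%:R - i%:R).
Proof.
rewrite /rampR; have [zi|iz] := leqP z i.
  have h : z%:R - i%:R <= 0 :> R by rewrite subr_le0 ler_nat.
  have h' : z%:R - i%:R - c <= 0 by rewrite subr_le0 (le_trans h).
  rewrite (pospow_le0 _ h) (pospow_le0 _ h') /ramp.
  by rewrite (_ : (z - i = 0)%N) ?muln0 ?minn0 ?subrr ?mulr0 //; lia.
rewrite -natrB ?(ltnW iz) //; move: (z - i)%N => y.
rewrite (pospow_ge0 _ (ler0n _ _)) expr1 /ramp.
have yc : (y%:R <= c) = (b * y <= q)%N.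
  by rewrite /c ler_pdivlMr // -natrM ler_nat mulnC.
have [h|h] := leqP (b * y) q.
  by rewrite pospow_le0 ?subr0 ?natrM // subr_le0 yc.
rewrite pospow_ge0 ?expr1; last by rewrite subr_ge0 ltW // ltNge yc -ltnNge.
by rewrite opprB addrC subrK /c mulrCA divff ?mulr1 // gt_eqF.
Qed.

Let ramp_int_le0 x : x <= 0 -> ramp_int x = 0.
Proof.
move=> x0; have xc : x - c <= 0 by rewrite subr_le0 (le_trans x0).
by rewrite /ramp_int (pospow_le0 _ x0) (pospow_le0 _ xc) subrr mulr0.
Qed.

Let ramp_int_step kappa x : 0 <= kappa ->
  `|ramp_int x - ramp_int (x - kappa) - kappa * rampR x| <= b%:R * kappa ^+ 2.
Proof.
move=> k0; have := pospow2_step x k0; have := pospow2_step (x - c) k0.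
rewrite /ramp_int /rampR (addrAC x (- c)).
set e1 := pospow 2 x; set e2 := pospow 2 (x - kappa); set e3 := pospow 1 x.
set e4 := pospow 2 (x - c); set e5 := pospow 2 (x - kappa - c); set e6 := pospow 1 (x - c).
move=> h2 h1.
rewrite (_ : _ - _ = b%:R / 2 * ((e1 - e2 - 2 * kappa * e3) - (e4 - e5 - 2 * kappa * e6)));
  last by field.
rewrite normrM ger0_norm ?divr_ge0 ?ler0n //.
have -> : b%:R * kappa ^+ 2 = b%:R / 2 * (kappa ^+ 2 + kappa ^+ 2) by field.
rewrite ler_wpM2l ?divr_ge0 ?ler0n //.
by apply: le_trans (ler_normB _ _) _; apply: lerD.
Qed.

Let ramp_int2_step kappa x : 0 <= kappa -> 0 <= x ->
  `|ramp_int2 (x + kappa) - ramp_int2 x - kappa * ramp_int x| <=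
     b%:R * kappa ^+ 2 * (x + kappa).
Proof.
move=> k0 x0; have := pospow3_step x k0; have := pospow3_step (x - c) k0.
have px : pospow 1 x = x by rewrite pospow_ge0.
have pxc : pospow 1 (x - c) <= x.
  by rewrite /pospow expr1 ge_max x0 /= gerBl.
rewrite /ramp_int2 /ramp_int px (addrAC x (- c)).
set p := pospow 1 (x - c) in pxc *.
set e1 := pospow 3 (x + kappa); set e2 := pospow 3 x; set e5 := pospow 2 x.
set e3 := pospow 3 (x + kappa - c); set e4 := pospow 3 (x - c); set e6 := pospow 2 (x - c).
move=> h2 h1.
rewrite (_ : _ - _ = b%:R / 6 * ((e1 - e2 - 3 * kappa * e5) - (e3 - e4 - 3 * kappa * e6)));
  last by field.
rewrite normrM ger0_norm ?divr_ge0 ?ler0n //.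
have hp : 0 <= kappa ^+ 2 * (x - p) by rewrite mulr_ge0 ?exprn_ge0 ?subr_ge0.
have k3 : 0 <= kappa ^+ 3 by rewrite exprn_ge0.
have -> : b%:R * kappa ^+ 2 * (x + kappa) =
  b%:R / 6 * (6 * kappa ^+ 2 * x + 6 * kappa ^+ 3) by field.
rewrite ler_wpM2l ?divr_ge0 ?ler0n //.
apply: le_trans (ler_normB _ _) _.
by apply: le_trans (lerD h1 h2) _; lra.
Qed.

(* No boundary term: the primitive vanishes at x - k n <= 0. *)
Let column_approx (k n : nat) x : x <= k%:R * n%:R ->
  `|ramp_int x - \sum_(i < n) k%:R * rampR (x - k%:R * i%:R)|
    <= n%:R * (b%:R * k%:R ^+ 2).
Proof.
move=> xn.
have := @telescope_approx _ (fun i => - ramp_int (x - k%:R * i%:R))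
  (fun i => k%:R * rampR (x - k%:R * i%:R)) (b%:R * k%:R ^+ 2) n.
rewrite mulr0 subr0 opprK (ramp_int_le0 (_ : x - k%:R * n%:R <= 0)); last by lra.
rewrite oppr0 add0r; apply => i _.
rewrite (_ : x - k%:R * i.+1%:R = x - k%:R * i%:R - k%:R); last by rewrite -natr1; ring.
by rewrite opprK [- _ + _]addrC; apply: ramp_int_step; rewrite ler0n.
Qed.

Let row_approx (k n : nat) :
  `|ramp_int2 (k%:R * n%:R) - \sum_(r < n) k%:R * ramp_int (k%:R * r%:R)|
    <= n%:R * (b%:R * k%:R ^+ 2 * (k%:R * n%:R)).
Proof.
have := @telescope_approx _ (fun i => ramp_int2 (k%:R * i%:R))
  (fun i => k%:R * ramp_int (k%:R * i%:R)) (b%:R * k%:R ^+ 2 * (k%:R * n%:R)) n.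
have -> : ramp_int2 (k%:R * 0%:R) = 0.
  have h : 0 - c <= 0 by rewrite subr_le0.
  by rewrite mulr0 /ramp_int2 (pospow_le0 _ h) (pospow_le0 _ (lexx 0)) subrr mulr0.
rewrite subr0; apply => i lt_in.
rewrite -natr1 mulrDr mulr1; apply: le_trans (ramp_int2_step _ _) _; rewrite ?mulr_ge0 ?ler0n //.
rewrite ler_wpM2l ?mulr_ge0 ?exprn_ge0 ?ler0n //.
by rewrite -[X in _ + X]mulr1 -mulrDr natr1 ler_wpM2l ?ler0n // ler_nat.
Qed.

(** Summing along a column, then over the rows, replaces the two double sums by
    H(k q) / k and H(q); the row sum has step k, hence the division by k, which
    is cleared in the proof. *)
Lemma sum_column_height_approx k : (0 < k)%N ->
  `|(\sum_(r < 2 * q) \sum_(s < k.+1 * q) column_height q b k r s)%N%:R -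
    (((k%:R + 1) - 6 * k%:R * b%:R + 3 * k%:R * (k%:R + 3) * b%:R ^+ 2)
       / (6 * k%:R * b%:R ^+ 2)) * q%:R ^+ 3|
  <= b%:R * (2 * k%:R ^+ 2 + k%:R + 1) * q%:R ^+ 2 :> R.
Proof.
move=> k0; rewrite sum_column_heightE // !natrD natrX natrM !natr_sum.
have kR : 0 < k%:R :> R by rewrite ltr0n.
have b1 : 1 <= b%:R :> R by rewrite ler1n.
have k1 : 1 <= k%:R :> R by rewrite ler1n.
pose Q : R := q%:R; have Q0 : 0 <= Q by rewrite ler0n.
set S1 := \sum_(r < q) _; set S2 := \sum_(r < q) _.
have e1 : `|\sum_(r < q) ramp_int (k%:R * r%:R) - S1| <= Q * (k%:R * Q * b%:R).
  rewrite -sumrB; apply: le_trans (ler_norm_sum _ _ _) _.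
  rewrite [X in _ <= X]mulr_natl -[X in _ <= _ *+ X](card_ord q) -sumr_const.
  apply: ler_sum => r _; rewrite natr_sum.
  have := @column_approx 1 (k * q) (k%:R * r%:R).
  rewrite mul1r expr1n mulr1 -!natrM ler_nat leq_mul2l (ltnW (ltn_ord r)) orbT.
  move=> /(_ isT); rewrite !natrM (eq_bigr (fun i : 'I_(k * q) => (ramp q b (k * r - i))%:R)) //.
  by move=> i _; rewrite !mul1r rampRE natrM.
have e2 : `|ramp_int2 (k%:R * Q) - \sum_(r < q) k%:R * ramp_int (k%:R * r%:R)|
    <= Q * (b%:R * k%:R ^+ 2 * (k%:R * Q)) := row_approx k q.
have e3 : `|\sum_(r < q) ramp_int (1%:R * r%:R) - k%:R * S2| <= Q * (Q * (b%:R * k%:R ^+ 2)).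
  rewrite mulr_sumr -sumrB; apply: le_trans (ler_norm_sum _ _ _) _.
  rewrite [X in _ <= X]mulr_natl -[X in _ <= _ *+ X](card_ord q) -sumr_const.
  apply: ler_sum => r _; rewrite !mul1r natr_sum mulr_sumr.
  have := @column_approx k q r%:R.
  rewrite -!natrM ler_nat (leq_trans (ltnW (ltn_ord r))) ?leq_pmull //.
  move=> /(_ isT); rewrite (eq_bigr (fun i : 'I_q => k%:R * (ramp q b (r - k * i))%:R)) //.
  by move=> i _; rewrite rampRE natrM.
have e4 : `|ramp_int2 (1%:R * Q) - \sum_(r < q) 1%:R * ramp_int (1%:R * r%:R)|
    <= Q * (b%:R * 1%:R ^+ 2 * (1%:R * Q)) := row_approx 1 q.
rewrite -mulr_sumr in e2; rewrite -mulr_sumr !mul1r expr1n mulr1 in e4.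
move: e1 e2 e3 e4.
under [X in `|X - k%:R * S2|]eq_bigr do rewrite mul1r.
under [X in `|_ - X| <= Q * (b%:R * _)]eq_bigr do rewrite mul1r.
set T1 := \sum_(r < q) ramp_int (k%:R * _); set T2 := \sum_(r < q) ramp_int _ => e1 e2 e3 e4.
rewrite -(ler_pM2l kR) -{1}(ger0_norm (ltW kR)) -normrM.
have bn0 : b%:R != 0 :> R by rewrite gt_eqF.
have kn0 : k%:R != 0 :> R by rewrite gt_eqF.
have ckQ : 0 <= k%:R * Q - c.
  rewrite /c subr_ge0 ler_pdivrMr //; apply: le_trans (ler_peMl Q0 k1) _.
  by rewrite ler_peMr // mulr_ge0 // ltW.
have cQ : 0 <= Q - c by rewrite /c subr_ge0 ler_pdivrMr // ler_peMr.
have hk : ramp_int2 (k%:R * Q) = b%:R / 6 * ((k%:R * Q) ^+ 3 - (k%:R * Q - c) ^+ 3).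
  by rewrite /ramp_int2 !pospow_ge0 // mulr_ge0 // ltW.
have h1 : ramp_int2 Q = b%:R / 6 * (Q ^+ 3 - (Q - c) ^+ 3).
  by rewrite /ramp_int2 !pospow_ge0.
(* Since c is proportional to q, the sum q^3 + H(k q) / k + H(q) is an exact
   multiple of q^3; only the four approximation errors remain. *)
rewrite (_ : k%:R * _ = - (k%:R * (T1 - S1) + (ramp_int2 (k%:R * Q) - k%:R * T1)
   + k%:R * (ramp_int2 Q - T2) + k%:R * (T2 - k%:R * S2))); last first.
  by rewrite hk h1 /c -/Q; field; rewrite bn0 kn0.
rewrite normrN; apply: le_trans (ler_normD _ _) _.
apply: le_trans (lerD (ler_normD _ _) (lexx _)) _.
apply: le_trans (lerD (lerD (ler_normD _ _) (lexx _)) (lexx _)) _.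
rewrite !(normrM k%:R) (ger0_norm (ltW kR)).
have e1' := ler_wpM2l (ltW kR) e1.
have e3' := ler_wpM2l (ltW kR) e3.
have e4' := ler_wpM2l (ltW kR) e4.
apply: le_trans (lerD (lerD (lerD e1' e2) e4') e3') _.
by rewrite -/Q le_eqVlt; apply/orP; left; apply/eqP; ring.
Qed.

End CountApprox.

(** * Length of the Frobenius quotient *)

Section MonomialQuotient.
Variables (F : fieldType) (a b : nat).
Local Open Scope classical_set_scope.
Local Notation A := (mono_algebra F a b).
Local Notation expo := (nat * nat * nat)%type.
Implicit Types (f g : A) (c : F) (u v w : expo).

(* Restating that val is a ring morphism at the type A keeps unification from
   unfolding the tower of algebraic structures on A. *)
Lemma val0 : \val (0 : A) = 0. Proof. by []. Qed.
Lemma valD f g : \val (f + g) = \val f + \val g. Proof. by []. Qed.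
Lemma valM f g : \val (f * g) = \val f * \val g. Proof. by []. Qed.

Lemma valX f n : \val (f ^+ n) = \val f ^+ n.
Proof. by elim: n => [|n IHn]; rewrite ?expr0 // !exprS valM IHn. Qed.

Lemma val_sum n (G : 'I_n -> A) : \val (\sum_(i < n) G i) = \sum_(i < n) \val (G i).
Proof. exact: (big_morph (fun f : A => \val f) valD val0). Qed.

Lemma coef3_outside f w : ~~ in_cone a b w -> coef3 (\val f) w = 0.
Proof.
have /asboolP/(_ w.1.1 w.1.2)[/ideal_powXn h1 /ideal_powXn h2] := valP f.
by rewrite negb_and -!ltnNge => /orP[/h1|/h2].
Qed.

Lemma mem_intersection_algebra (f : {poly {poly {poly F}}}) :
  (forall w, ~~ in_cone a b w -> coef3 f w = 0) ->
  f \in in_intersection_algebra (ideal_gen [set 'X^a : {poly F}])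
                       (ideal_gen [set 'X^b : {poly F}]).
Proof.
move=> h; apply/asboolP => r s.
by split; apply/ideal_powXn => t lt; apply: (h (r, s, t));
  rewrite negb_and -!ltnNge lt ?orbT.
Qed.

(** The monomial c x^t u^r v^s as an element of the algebra.  It is made total
    by the value 0 outside the cone, which is harmless in expansions because the
    coefficients there vanish. *)
Definition term c w : A :=
  insubd (0 : A) (c%:P%:P%:P * mono F w.1.1 w.1.2 w.2).

Lemma term0 w : term 0 w = 0.
Proof.
apply: val_inj; rewrite /term !polyC0 mul0r val_insubd.
by case: ifP.
Qed.

Lemma val_term c w : in_cone a b w ->
  \val (term c w) = c%:P%:P%:P * mono F w.1.1 w.1.2 w.2.
Proof.
move=> hw; rewrite /term val_insubd mem_intersection_algebra // => v.
rewrite coef3C coef3_mono; case: eqP => [<-|_]; last by rewrite mulr0.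
by rewrite -!surjective_pairing hw.
Qed.

Lemma val_term1 w : in_cone a b w -> \val (term 1 w) = mono F w.1.1 w.1.2 w.2.
Proof. by move=> hw; rewrite val_term // !polyC1 mul1r. Qed.

Definition add3 u v : expo := (u.1.1 + v.1.1, u.1.2 + v.1.2, u.2 + v.2)%N.
Definition mul3 (q : nat) u : expo := (q * u.1.1, q * u.1.2, q * u.2)%N.

Lemma term_frobenius_mul c q u v : in_cone a b u -> in_cone a b v ->
  in_cone a b (add3 (mul3 q u) v) ->
  term c (add3 (mul3 q u) v) = term c v * term 1 u ^+ q.
Proof.
move=> hu hv hw; apply: val_inj.
rewrite valM valX (val_term c hw) (val_term c hv) (val_term1 hu).
by rewrite mono_exp -mulrA mono_mul /= ![(_ * _ + _)%N]addnC.
Qed.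

Lemma coef3_term_mul c f w : coef3 (\val (term c (0, 0, 0)%N * f)) w = c * coef3 (\val f) w.
Proof.
rewrite valM val_term ?/in_cone ?muln0 //=.
by rewrite -mulrA coef3C /mono !expr0 !polyC1 !mul1r.
Qed.

Lemma term_expand f : exists n, f =
  \sum_(s < n) \sum_(r < n) \sum_(t < n)
     term (coef3 (\val f) (nat_of_ord r, nat_of_ord s, nat_of_ord t))
        (nat_of_ord r, nat_of_ord s, nat_of_ord t).
Proof.
have [n fE] := poly3_expand (\val f); exists n; apply: val_inj.
rewrite {1}fE val_sum; apply: eq_bigr => s _.
rewrite val_sum; apply: eq_bigr => r _.
rewrite val_sum; apply: eq_bigr => t _.
have [hw|hw] := boolP (in_cone a b (nat_of_ord r, nat_of_ord s, nat_of_ord t)).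
  by rewrite val_term.
by rewrite coef3_outside // term0 polyC0 mul0r.
Qed.

Variables (p e : nat).
Hypothesis charF : p \in [pchar F].
Let q := (p ^ e)%N.
Local Notation m := (@mono_max_ideal F a b).
Local Notation mq := (frobenius_power m q).

(* A list of all the standard exponents, by decreasing degree. *)
Variable ws : seq expo.
Hypothesis ws_uniq : uniq ws.
Hypothesis ws_sorted :
  sorted (fun u v => v.1.1 + v.1.2 + v.2 <= u.1.1 + u.1.2 + u.2)%N ws.
Hypothesis ws_cone : forall w, w \in ws -> in_cone a b w.
Hypothesis ws_standard : forall u v, u != (0, 0, 0)%N ->
  in_cone a b u -> in_cone a b v -> add3 (mul3 q u) v \notin ws.
Hypothesis ws_complete : forall w, in_cone a b w -> w \notin ws ->
  exists u v, [/\ u != (0, 0, 0)%N, in_cone a b u, in_cone a b v &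
                  w = add3 (mul3 q u) v].
Let N := size ws.
Let w_ j := nth (0, 0, 0)%N ws j.

(* A divisor of a standard monomial is standard. *)
Let ws_factor u v : in_cone a b u -> in_cone a b v -> add3 u v \in ws -> v \in ws.
Proof.
move=> hu hv; apply: contraLR => /(ws_complete hv)[u' [v' [u'0 hu' hv' ->]]].
rewrite (_ : add3 _ _ = add3 (mul3 q u') (add3 u v')); last first.
  by rewrite /add3 /=; congr (_, _, _); rewrite addnCA.
apply: ws_standard => //; move: hu hv'; rewrite /in_cone /= !mulnDr.
by move=> /andP[h1 h2] /andP[h3 h4]; rewrite !leq_add.
Qed.

Definition filtration (i : nat) : set A :=
  [set f : A | forall j, (i <= j < N)%N -> coef3 (\val f) (w_ j) = 0].

(** In a product, the monomials of the second factor that contribute to the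
    coefficient at w_j divide the standard monomial w_j.  So they are standard,
    and each is w_j itself or has smaller degree and comes later in the list. *)
Lemma filtration_ideal i : is_ideal (filtration i).
Proof.
split=> [j _|c x y Kx Ky j hj]; first exact: coef3_0.
rewrite valD coef3D (Ky j hj) addr0 valM.
have /andP[ij jN] := hj; apply: coef3M_eq0 => r s t r' s' t' /= rst.
have [hu|/coef3_outside->] := boolP (in_cone a b (r, s, t)); last by rewrite mul0r.
have [hv|/coef3_outside->] := boolP (in_cone a b (r', s', t')); last by rewrite mulr0.
have wj : w_ j \in ws by rewrite mem_nth.
have vws : (r', s', t') \in ws by apply: ws_factor hu hv _; rewrite /add3 /= rst.
suff jv : (j <= index (r', s', t') ws)%N.
  rewrite -(nth_index (0, 0, 0)%N vws) (Kx (index (r', s', t') ws)) ?mulr0 //.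
  by rewrite (leq_trans ij jv) index_mem.
rewrite leqNgt; apply/negP => vj.
have := sorted_leq_nth _ _ (0, 0, 0)%N ws_sorted.
move=> /(_ _ _ _ _ _ _ (ltnW vj)).
have tr : transitive (fun u v : expo => v.1.1 + v.1.2 + v.2 <= u.1.1 + u.1.2 + u.2)%N.
  by move=> u v w h1 h2; apply: leq_trans h2 h1.
move=> /(_ tr (fun=> leqnn _)); rewrite !inE jN index_mem => /(_ vws isT).
rewrite (nth_index _ vws) -/(w_ j) -rst /= => le.
move: vj; rewrite (_ : (r', s', t') = w_ j) ?index_uniq ?ltnn // -rst.
congr (_, _, _); lia.
Qed.

(** The f whose q-th power has no standard monomial form an ideal, because
    Frobenius is additive; so it suffices to look at monomials f. *)
Lemma frobenius_power_filtration : mq `<=` filtration 0.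
Proof.
apply: smallest_sub; first exact: filtration_ideal.
have charP : [pchar {poly {poly {poly F}}}].-nat q.
  rewrite /q pnatX; apply/orP; left.
  by rewrite pnatE ?(pcharf_prime charF) // !pchar_poly.
pose K : set A := [set f : A | filtration 0 (f ^+ q)].
suff : m `<=` K by move=> mK _ [f /mK fK <-].
apply: smallest_sub.
  split.
    rewrite /K /= expr0n gtn_eqF ?expn_gt0 ?prime_gt0 ?(pcharf_prime charF) //.
    by case: (filtration_ideal 0).
  move=> c x y Kx Ky; rewrite /K /=.
  rewrite (_ : (c *: (x : A^o) + y) ^+ q = (c ^+ q) * (x ^+ q) + y ^+ q); last first.
    apply: val_inj; rewrite valX valD valM exprDn_pchar //.
    by rewrite valD valM !valX exprMn.
  apply: (is_idealD (filtration_ideal 0)) Ky.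
  exact: (is_idealMl _ (filtration_ideal 0) Kx).
move=> f [r [s [t [nz fE]]]] j /= jN; rewrite valX fE mono_exp.
rewrite coef3_mono; case: eqP => // wE.
have hw : in_cone a b (r, s, t).
  apply: contraT => /(coef3_outside f); rewrite fE coef3_mono eqxx => /eqP.
  by rewrite oner_eq0.
have := @ws_standard (r, s, t) (0, 0, 0)%N nz hw.
rewrite /add3 /mul3 /= !addn0 wE mem_nth // => /(_ _)/negP[] //.
by rewrite /in_cone /= !muln0.
Qed.

(** Every monomial of such an f is divisible by the q-th power of a monomial
    of m. *)
Lemma filtration0_frobenius_power : filtration 0 `<=` mq.
Proof.
move=> f Kf; have [n ->] := term_expand f.
have idU := is_ideal_frobenius_power m q.
do 3![apply: (is_ideal_sum idU) => ?].
set w := (_, _, _).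
have [hw|hw] := boolP (in_cone a b w); last first.
  by rewrite coef3_outside // term0; case: idU.
have [wws|wws] := boolP (w \in ws).
  rewrite -(nth_index (0, 0, 0)%N wws) (Kf (index w ws)) ?index_mem //.
  by rewrite term0; case: idU.
have [u [v [nz hu hv wE]]] := ws_complete hw wws.
rewrite wE term_frobenius_mul // -?wE //; apply: (is_idealMl _ idU).
apply: sub_ideal_gen; exists (term 1 u) => //; apply: sub_ideal_gen.
exists u.1.1, u.1.2, u.2; split; first by rewrite -!surjective_pairing.
by rewrite val_term1.
Qed.

Lemma filtration_chain :
  chain_above (V := A^o) mq N filtration.
Proof.
split=> [i _|i iN].
  split; first exact: filtration_ideal.
  by move=> f /frobenius_power_filtration Kf j /andP[_ jN]; apply: Kf.
split=> [f Kf j /andP[ij jN]|K].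
  by apply: Kf; rewrite (ltnW ij).
have hw : in_cone a b (w_ i) by apply/ws_cone/mem_nth.
have E j : coef3 (\val (term 1 (w_ i))) (w_ j) = (w_ i == w_ j)%:R.
  by rewrite val_term1 // coef3_mono -!surjective_pairing.
have : filtration i (term 1 (w_ i)).
  apply: K => j /andP[ij jN]; rewrite E nth_uniq // ltn_eqF //.
move=> /(_ i); rewrite leqnn iN E eqxx => /(_ isT)/eqP.
by rewrite oner_eq0.
Qed.

(** Pick x_i in K_(i+1) outside K_i.  Their standard coefficient vectors are
    independent: a vanishing combination lies in m^[q], hence in every K_i, and
    solving for its last term x_i would put x_i into K_i. *)
Lemma chain_length_le n (K : nat -> set A^o) :
  chain_above (V := A^o) mq n K -> (n <= N)%N.
Proof.
move=> [Kid Klt].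
have Kmono i j : (i <= j <= n)%N -> K i `<=` K j.
  elim: j => [|j IHj]; first by rewrite leqn0 => /andP[/eqP-> _] x.
  move=> /andP[]; rewrite leq_eqVlt => /orP[/eqP-> _ x //|ij jn].
  by apply: subset_trans (Klt j jn).1; apply: IHj; rewrite -ltnS ij ltnW.
have /choice[x Kx] : forall i : 'I_n, exists x : A, K i.+1 x /\ ~ K i x.
  move=> i; have [_ /existsNP[x /not_implyP Hx]] := Klt i (ltn_ord i).
  by exists x.
pose M := \matrix_(i < n, j < N) coef3 (\val (x i)) (w_ j).
suff /eqP <- : row_free M by exact: rank_leq_col.
apply: inj_row_free => v vM; apply/eqP; apply: contraT => v0.
have [i0 vi0] : exists i, v 0 i != 0.
  apply/existsP; apply: contraNT v0 => /existsPn h; apply/eqP/rowP => i.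
  by rewrite mxE; apply/eqP; rewrite -[_ == _]negbK h.
case: (@arg_maxnP _ i0 (fun i => v 0 i != 0) (fun i : 'I_n => nat_of_ord i) vi0) => {vi0}i0 vi0 imax.
have [[K0 Kcl] UK] := Kid i0 (ltnW (ltn_ord i0)).
have Kideal : is_ideal (K i0) := conj K0 Kcl.
case: (Kx i0) => _; case.
have Ky : K i0 (\sum_i term (v 0 i) (0, 0, 0)%N * x i).
  apply: UK; apply: filtration0_frobenius_power => j /= jN.
  rewrite val_sum coef3_sum.
  under eq_bigr do rewrite coef3_term_mul.
  have /rowP/(_ (Ordinal jN)) := vM; rewrite !mxE => {2}<-.
  by apply: eq_bigr => i _; rewrite mxE.
have Krest : K i0 (\sum_(i < n | i != i0) term (v 0 i) (0, 0, 0)%N * x i).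
  elim/big_ind: _ => // [y z|i ii0]; first exact: (is_idealD Kideal).
  have [ii|ii] := leqP i i0; last first.
    suff /eqP -> : v 0 i == 0 by rewrite term0 mul0r.
    by apply: contraLR ii => /imax; rewrite -leqNgt.
  apply: (is_idealMl _ Kideal); apply: (Kmono i.+1 i0); last by case: (Kx i).
  by rewrite ltn_neqAle ii ii0 /= ltnW.
have Kt : K i0 (term (v 0 i0) (0, 0, 0)%N * x i0).
  have := is_idealB Kideal Ky Krest.
  by rewrite (bigD1 i0) //= addrK.
have := is_idealMl (term (v 0 i0)^-1 (0, 0, 0)%N) Kideal Kt.
congr (K i0 _); apply: val_inj; apply: coef3_inj => w.
by rewrite !coef3_term_mul mulrA mulVf ?mul1r.
Qed.

Lemma module_length_monomial_quotient (R : realType) :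
  module_length R (quotient_module (is_ideal_frobenius_power m q)) = N%:R%:E.
Proof.
apply: module_length_quotientE; first exact: chain_length_le.
by exists filtration; exact: filtration_chain.
Qed.

End MonomialQuotient.

(** * The limit *)

Definition standard_exponents q b k : seq (nat * nat * nat) :=
  [seq (u.1, u.2, floor_height b k u.1 u.2 + t)%N
     | u <- [seq (r, s) | r <- iota 0 (2 * q), s <- iota 0 (k.+1 * q)],
       t <- iota 0 (column_height q b k u.1 u.2)].

Lemma mem_standard_exponents q b k w :
  (w \in standard_exponents q b k) =
  (in_cone (k * b) b w && [&& w.1.1 < 2 * q, w.1.2 < k.+1 * q &
    w.2 < floor_height b k w.1.1 w.1.2 + column_height q b k w.1.1 w.1.2]%N).
Proof.
rewrite /in_cone -floor_heightE; apply/allpairsPdep/idP => [[u [t [hu ht ->]]]|].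
  move/allpairsP: hu => [[r s] /= [hr hs uE]]; rewrite uE /= in ht *.
  by move: hr hs ht; rewrite !mem_iota /= !add0n => -> -> ht; rewrite leq_addr ltn_add2l.
move: w => [[r s] t] /= /and4P[h1 h2 h3 h4].
exists (r, s), (t - floor_height b k r s)%N; split.
- by apply/allpairsP; exists (r, s); rewrite !mem_iota.
- by rewrite mem_iota /= add0n; lia.
- by rewrite subnKC.
Qed.

Lemma uniq_standard_exponents q b k : uniq (standard_exponents q b k).
Proof.
apply: allpairs_uniq_dep => [|u _|]; rewrite ?iota_uniq //.
  by apply: allpairs_uniq; rewrite ?iota_uniq // => -[? ?] [? ?] _ _ [-> ->].
move=> [[r s] t] [[r' s'] t'] _ _ /= [-> -> /addnI ->] //.
Qed.

Lemma size_standard_exponents q b k : size (standard_exponents q b k) =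
  (\sum_(r < 2 * q) \sum_(s < k.+1 * q) column_height q b k r s)%N.
Proof.
rewrite size_allpairs_dep sumnE big_map.
under eq_bigr do rewrite size_iota.
rewrite big_allpairs_dep.
under eq_bigr do rewrite -[X in iota 0 X]subn0 -/(index_iota _ _) big_mkord.
by rewrite -[X in iota 0 X]subn0 -/(index_iota _ _) big_mkord.
Qed.

Lemma length_frobenius_quotient (R : realType) (F : fieldType) (p b k e : nat) :
  p \in [pchar F] -> (0 < k)%N -> (0 < b)%N ->
  module_length R (quotient_module
     (is_ideal_frobenius_power (@mono_max_ideal F (k * b) b) (p ^ e))) =
  (\sum_(r < 2 * p ^ e) \sum_(s < k.+1 * p ^ e) column_height (p ^ e) b k r s)%N%:R%:E.
Proof.
move=> charF k0 b0; set q := (p ^ e)%N.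
have q0 : (0 < q)%N by rewrite expn_gt0 prime_gt0 // (pcharf_prime charF).
pose ord (u v : nat * nat * nat) := (v.1.1 + v.1.2 + v.2 <= u.1.1 + u.1.2 + u.2)%N.
rewrite -size_standard_exponents -(size_sort ord).
apply: module_length_monomial_quotient => //.
- by rewrite sort_uniq uniq_standard_exponents.
- by apply: sort_sorted => u v; exact: leq_total.
- by move=> w; rewrite mem_sort mem_standard_exponents => /andP[].
- move=> u v nz hu hv; rewrite mem_sort mem_standard_exponents.
  apply/negP => /andP[_ /and3P[_ _]]; rewrite ltnNge => /negP; apply.
  exact: (standard_not_shift q0 b0 nz hu hv).
- move=> w hw; rewrite mem_sort mem_standard_exponents hw /=.
  by move/(nonstandard_shift q0 b0 k0 hw).
Qed.

(** The relative error C / p^e is at most C / (e + 1). *)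
Lemma cvg_of_quadratic_error (R : realType) (p : nat) (u : nat -> R) (l C : R) :
  (1 < p)%N ->
  (forall e, `|u e - l * (p ^ e)%:R ^+ 3| <= C * (p ^ e)%:R ^+ 2) ->
  ((fun e => (u e)%:E * ((p ^ (3 * e))%:R^-1)%:E)%E @ \oo --> l%:E)%classic.
Proof.
move=> p1 hu.
have C0 : 0 <= C by have := le_trans (normr_ge0 _) (hu 0%N); rewrite expn0 expr1n mulr1.
apply: cvg_EFin; first by apply: nearW => e; rewrite -EFinM.
apply/cvgrPdist_le => eps eps0.
have := cvgMl_tmp (FF := eventually_filter) (a := C) (@cvg_harmonic R).
rewrite mulr0 => /cvgrPdist_le/(_ _ eps0); apply: filterS => e /=.
rewrite sub0r normrN => le; apply: le_trans le.
have Q0 : 0 < (p ^ e)%:R :> R by rewrite ltr0n expn_gt0 ltnW.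
rewrite mulnC expnM natrX distrC.
rewrite (_ : _ - l = (u e - l * (p ^ e)%:R ^+ 3) / (p ^ e)%:R ^+ 3); last first.
  by field; rewrite gt_eqF.
rewrite normrM normfV (ger0_norm (exprn_ge0 3 (ltW Q0))).
rewrite ler_pdivrMr ?exprn_gt0 //; apply: le_trans (hu e) _.
rewrite ger0_norm; last by rewrite mulr_ge0 // harmonic_ge0.
rewrite -mulrA ler_wpM2l // [_ ^+ 3]exprS mulrA ler_peMl ?exprn_ge0 ?(ltW Q0) //.
by rewrite /harmonic /= ler_pdivlMl ?ltr0n // mulr1 ler_nat ltn_expl.
Qed.

Theorem theorem4p7 (R : realType) (F : fieldType) (p : nat)
    (charF : p \in [pchar F]) (a b k : nat)
    (k_gt0 : (0 < k)%N) (b_gt0 : (0 < b)%N) (a_eq : a = (k * b)%N) :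
  has_hilbert_kunz_multiplicity p 3 (@mono_max_ideal F a b)
    (((k%:R + 1) - 6 * k%:R * b%:R + 3 * k%:R * (k%:R + 3) * b%:R ^+ 2)
       / (6 * k%:R * b%:R ^+ 2) : R)
  /\ ((k%:R + 1) - 6 * k%:R * b%:R + 3 * k%:R * (k%:R + 3) * b%:R ^+ 2)
       / (6 * k%:R * b%:R ^+ 2)
     = (a%:R + b%:R - 6 * a%:R * b%:R + 3 * a%:R ^+ 2 * b%:R
          + 9 * a%:R * b%:R ^+ 2) / (6 * a%:R * b%:R ^+ 2) :> R.
Proof.
subst a; split.
  rewrite /has_hilbert_kunz_multiplicity.
  under eq_fun do rewrite (length_frobenius_quotient R _ charF k_gt0 b_gt0).
  apply: cvg_of_quadratic_error => [|e].
    by rewrite prime_gt1 // (pcharf_prime charF).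
  exact: sum_column_height_approx.
by rewrite natrM; field; rewrite !pnatr_eq0 -!lt0n k_gt0 b_gt0.
Qed.
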